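(* Let $G$ be a finite group of order at least $6$, and let $m$ be the integer part of $|G|/2$. Then $G$ acts in a regular transitive manner on a partial orthogonal spread of size $|G|$ defined on a quadratic space of dimension $2^m$ over $\mathbb{F}_2$. That is, there exist a vector space $V$ of dimension $2^m$ over $\mathbb{F}_2$, a non-degenerate quadratic form $Q$ on $V$ of index $2^{m-1}$, a linear action of $G$ on $V$ by isometries of $Q$, and a partial orthogonal spread of size $|G|$ in $V$ whose subspaces are permuted regularly (transitively with trivial point stabilizers) by $G$.
   Context: A quadratic form on a vector space $V$ over a finite field $K$ of characteristic 2 is a function $Q:V\to K$ with $Q(\lambda u)=\lambda^2Q(u)$ and $Q(u+v)=Q(u)+Q(v)+f(u,v)$ for all $\lambda\in K$, $u,v\in V$, where $f$ is an alternating bilinear form (the polarization of $Q$). $Q$ is non-degenerate if $f$ is non-degenerate. An isometry of $Q$ is a linear automorphism $\sigma$ of $V$ with $Q(\sigma v)=Q(v)$ for all $v\in V$. A subspace is totally singular if $Q$ vanishes on all its elements. If $\dim V=2r$, a non-degenerate $Q$ has index $r$ if there is an $r$-dimensional totally singular subspace; in that case a partial orthogonal spread is a set of $r$-dimensional totally singular subspaces of $V$ that pairwise intersect trivially. *)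

(* Defs.v *)
From HB Require Import structures.
From mathcomp Require Import all_boot all_order all_fingroup all_algebra.
From mathcomp Require Import finmap.

Set Implicit Arguments.
Unset Strict Implicit.
Unset Printing Implicit Defensive.

Import GRing.Theory.
Local Open Scope ring_scope.

Section QuadraticSpaces.

Variables (K : finFieldType) (V : vectType K).
Implicit Types (U W : {vspace V}) (S : {fset {vspace V}}).

(* Meant for [K] of characteristic 2: in odd characteristic, asking for the
   polarization to be alternating would force [Q = 0]. *)
Record quadratic_form := QuadraticForm {
  qform :> V -> K;
  polarization : {biscalar V};
  qformZ : forall a u, qform (a *: u) = a ^+ 2 * qform u;
  qformD : forall u v, qform (u + v) = qform u + qform v + polarization u v;
  polarization_alternating : forall u, polarization u u = 0
}.

Implicit Type Q : quadratic_form.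

Definition nondegenerate_qform Q : Prop :=
  forall u, (forall v, polarization Q u v = 0) -> u = 0.

Definition qform_isometry Q (s : 'End(V)) : Prop :=
  lker s = 0%VS /\ forall v, Q (s v) = Q v.

Definition totally_singular Q U : Prop := {in U, forall u, Q u = 0}.

Definition has_index Q (r : nat) : Prop :=
  [/\ nondegenerate_qform Q, \dim {:V} = (2 * r)%N
    & exists U, \dim U = r /\ totally_singular Q U].

(* To be used when [has_index Q r] holds. *)
Definition partial_orthogonal_spread Q (r : nat) S : Prop :=
  (forall U, U \in S -> \dim U = r /\ totally_singular Q U) /\
  (forall U W, U \in S -> W \in S -> U != W -> (U :&: W = 0)%VS).

(* Left actions: [rho (g * h) = rho g \o rho h]. Values of [rho] outside [G]
   are irrelevant. *)
Definition linear_action (gT : finGroupType) (G : {group gT})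
    (rho : gT -> 'End(V)) : Prop :=
  rho 1%g = \1%VF /\ {in G &, forall g h, rho (g * h)%g = (rho g \o rho h)%VF}.

Definition permutes_regularly (gT : finGroupType) (G : {group gT})
    (rho : gT -> 'End(V)) S : Prop :=
  [/\ forall g U, g \in G -> U \in S -> (rho g @: U)%VS \in S,
      forall U W, U \in S -> W \in S ->
        exists2 g, g \in G & (rho g @: U)%VS = W
    & forall g U, g \in G -> U \in S -> (rho g @: U)%VS = U -> g = 1%g].

End QuadraticSpaces.

(* Main.v *)
(** Let [n = |G|]. A quadratic space over F_2 containing [n] singular vectors with
    all mutual products equal to 1 has a spin module [V] of dimension [2 ^ m]: the
    vectors act on [V] by operators [w_i] with [w_i ^ 2 = 0] and
    [w_i w_j + w_j w_i = 1], and their commutant is F_2. Hence the kernels of the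
    [w_i] have dimension [2 ^ (m - 1)] and pairwise intersect trivially. There is a
    nondegenerate form for which all [w_i] are self-adjoint, and
    [Q x = form (w_i x) (w_j x)] is a quadratic form polarizing to it and vanishing
    on the kernels of [w_i] and [w_j]. It does not depend on [i != j] as soon as
    three further indices are available, i.e. for [n >= 6]. A transposition [(i j)]
    of the indices is induced by conjugation with [w_i + w_j]; as the commutant is
    F_2, whose unit group is trivial, every permutation of the indices is induced
    by a unique isometry, and [G] acts through its regular representation. *)

Require Import Defs.
From HB Require Import structures.
From mathcomp Require Import all_boot all_order all_fingroup all_algebra.
From mathcomp Require Import finmap ring.

Set Implicit Arguments.
Unset Strict Implicit.
Unset Printing Implicit Defensive.

Local Open Scope ring_scope.

Import GRing.Theory.

(** * Vector spaces over F_2 *)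

Section CharacteristicTwo.

Variable V : lmodType 'F_2.
Implicit Types x y z : V.

Lemma addvv x : x + x = 0.
Proof. by rewrite -[x]scale1r -scalerDl (_ : 1 + 1 = 0) ?scale0r //; apply/eqP. Qed.

Lemma addKvv x y : x + (x + y) = y.
Proof. by rewrite addrA addvv add0r. Qed.

Lemma addv_eq0 x y : x + y = 0 -> x = y.
Proof. by move=> e; rewrite -[x]addr0 -(addvv y) addrA e add0r. Qed.

Lemma F2E (c : 'F_2) : c = 0 \/ c = 1.
Proof. by case: c => [[|[|//]] lt_c]; [left | right]; apply: val_inj. Qed.

Lemma additive_scalable_F2 (W : lmodType 'F_2) (f : V -> W) :
  {morph f : x y / x + y} -> forall c, {morph f : x / c *: x}.
Proof.
move=> fD c x; case: (F2E c) => ->; rewrite ?scale1r // !scale0r.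
by apply: (addrI (f 0)); rewrite -fD !addr0.
Qed.

End CharacteristicTwo.

(** In a sum claimed to vanish, a second copy of the head summand is moved left until the two
    cancel. *)
Ltac char2_step :=
  match goal with
  | |- ?x + ?r = 0 =>
    match r with
    | x => exact: addvv
    | x + _ => rewrite addKvv
    | context [?y + (x + ?s)] => rewrite (addrCA y x s)
    | context [?y + x] => rewrite (addrC y x)
    end
  end.
Ltac char2 :=
  apply: addv_eq0; rewrite ?add0r ?addr0 -?addrA; repeat char2_step.

(** * Block operators and spin modules *)

Section BlockOperators.

Variable V : vectType 'F_2.
Variables a b c d : 'End(V).

Definition block_fun (p : V * V) : V * V :=
  (a p.1 + b p.2, c p.1 + d p.2).

Fact block_fun_linear : linear block_fun.
Proof.
move=> k p q; rewrite /block_fun /= !linearP /=; congr pair => /=;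
by rewrite scalerDr addrACA.
Qed.

HB.instance Definition _ :=
  GRing.isLinear.Build 'F_2 (V * V)%type (V * V)%type _ block_fun block_fun_linear.

Definition block_op : 'End((V * V)%type) := linfun block_fun.

Lemma block_opE x y : block_op (x, y) = (a x + b y, c x + d y).
Proof. by rewrite lfunE. Qed.

End BlockOperators.

(* [gamma] is only meaningful on [0, 2m]. The last operator [gamma m.*2] is
   affinely dependent on the others, which is why the commutant clause omits it. *)
Record spin_module (m : nat) := SpinModule {
  spinor :> vectType 'F_2;
  gamma : nat -> 'End(spinor);
  spin_form : spinor -> spinor -> 'F_2;
  dim_spinor : \dim {:spinor} = (2 ^ m)%N;
  gammaK : forall i x, (i <= m.*2)%N -> gamma i (gamma i x) = 0;
  gamma_anti : forall i j x, (i < j)%N -> (j <= m.*2)%N ->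
    gamma i (gamma j x) + gamma j (gamma i x) = x;
  spin_formP : forall y, scalar (spin_form^~ y);
  spin_formC : forall x y, spin_form x y = spin_form y x;
  spin_form_nondegenerate : forall x, (forall y, spin_form x y = 0) -> x = 0;
  gamma_adjoint : forall i x y, (i <= m.*2)%N ->
    spin_form (gamma i x) y = spin_form x (gamma i y);
  gamma_commutant : forall a : spinor -> spinor, {morph a : x y / x + y} ->
    (forall i x, (i < m.*2)%N -> a (gamma i x) = gamma i (a x)) ->
    exists c, forall x, a x = c *: x
}.

(** Only the index [0] is in range, so the zero operator on a line will do; the anticommutation
    relation is vacuous. *)
Lemma spin_module0 : spin_module 0.
Proof.
refine (@SpinModule 0 (('F_2)^o : vectType 'F_2) (fun=> 0)
  (fun x y : 'F_2 => x * y) _ _ _ _ _ _ _ _).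
- by rewrite dimvf.
- by move=> i x _; rewrite lfunE.
- by move=> i j x lt_ij; rewrite double0 leqn0 => /eqP j0; rewrite j0 in lt_ij.
- by move=> y c x x'; rewrite mulrDl -[c *: x]/(c * x) -mulrA.
- by move=> x y; rewrite mulrC.
- by move=> x /(_ 1); rewrite mulr1.
- by move=> i x y _; rewrite !lfunE /= mul0r mulr0.
move=> a aD _; exists (a 1) => x; have := additive_scalable_F2 aD x 1.
by rewrite -[x *: 1]/(x * 1) mulr1 => ->; rewrite -[LHS]/(x * _) mulrC.
Qed.

(** * Doubling a spin module *)

Section Doubling.

Variables (m : nat) (S : spin_module m).
Local Notation V := (spinor S).
Let z : 'End(V) := gamma S m.*2.

(* On [F_2^2 (x) V], with [e] and [f] the off-diagonal matrix units acting on
   [F_2^2] and [z] the last operator of the odd family on [V], the new operators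
   are [z + e], [z + f] and [z + e + f + 1]; the form is the tensor product with
   the hyperbolic plane. *)
Definition double_gamma i : 'End((V * V)%type) :=
  if (i < m.*2)%N then block_op (gamma S i) 0 0 (gamma S i)
  else if i == m.*2 then block_op z \1%VF 0 z
  else if i == m.*2.+1 then block_op z 0 \1%VF z
  else block_op (z + \1%VF) \1%VF \1%VF (z + \1%VF).

Definition double_form (p q : V * V) : 'F_2 :=
  spin_form p.1 q.2 + spin_form p.2 q.1.

Let spin_formDl (x x' y : V) : spin_form (x + x') y = spin_form x y + spin_form x' y.
Proof. by have := spin_formP y 1 x x'; rewrite scale1r mul1r. Qed.
Let spin_formDr (x y y' : V) : spin_form x (y + y') = spin_form x y + spin_form x y'.
Proof. by rewrite ![spin_form x _]spin_formC spin_formDl. Qed.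

Let spin_form0l (y : V) : spin_form 0 y = 0.
Proof. by have := spin_formDl 0 0 y; rewrite addr0 -[LHS]addr0 => /addrI. Qed.

(** Indexed by the three tests of [double_gamma], so that one case split resolves its
    conditionals. *)
Variant gamma_index : nat -> bool -> bool -> bool -> Type :=
| GammaOld i of (i < m.*2)%N : gamma_index i true (i == m.*2) (i == m.*2.+1)
| GammaNew0 : gamma_index m.*2 false true (m.*2 == m.*2.+1)
| GammaNew1 : gamma_index m.*2.+1 false false true
| GammaNew2 : gamma_index m.*2.+2 false false false.

Lemma gamma_indexP i : (i <= m.+1.*2)%N ->
  gamma_index i (i < m.*2)%N (i == m.*2) (i == m.*2.+1).
Proof.
move=> le_i; case: ltnP => [|ge]; first by move=> ?; constructor.
case: eqP => [->|/eqP ne0]; first by constructor.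
case: eqP => [->|/eqP ne1]; first by constructor.
suff -> : i = m.*2.+2 by constructor.
apply/eqP; rewrite eqn_leq -doubleS le_i doubleS /= ltn_neqAle eq_sym ne1.
by rewrite ltn_neqAle eq_sym ne0.
Qed.

Let gE := (add_lfunE, id_lfunE, zero_lfunE).

(** Cross terms of commuting operators cancel in pairs; what remains are the squares of [z], [e] and
    [f], which vanish, and [(e + f)^2 + 1 = 0]. *)
Lemma double_gammaK i x : (i <= m.+1.*2)%N -> double_gamma i (double_gamma i x) = 0.
Proof.
case: x => x y /gamma_indexP; rewrite /double_gamma.
have zK u : z (z u) = 0 by apply: gammaK.
case=> [{}i lt_i|||]; rewrite !block_opE ?gE /= ?gE /= ?linearD /= ?linear0;
  congr pair; rewrite ?gammaK ?zK ?(ltnW lt_i) //=; try by char2.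
Qed.

(** An old operator has anticommutator 1 with the summand [z] and 0 with the rest; between two new
    operators only [e f + f e = 1] survives. *)
Lemma double_gamma_anti i j x : (i < j)%N -> (j <= m.+1.*2)%N ->
  double_gamma i (double_gamma j x) + double_gamma j (double_gamma i x) = x.
Proof.
case: x => x y lt_ij le_j; have le_i := leq_trans (ltnW lt_ij) le_j.
have zK u : z (z u) = 0 by apply: gammaK.
have zA k u : (k < m.*2)%N -> gamma S k (z u) = z (gamma S k u) + u.
  by move=> lt_k; apply: addv_eq0; rewrite addrA gamma_anti // addvv.
have addpE (a b c d : V) : (a, b) + (c, d) = (a + c, b + d) by [].
move: lt_ij; rewrite /double_gamma.
case: (gamma_indexP le_j) => [{le_j}j lt_j|||].
- case: (gamma_indexP le_i) => [{le_i}i lt_i|||] lt_ij; last first.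
  + by have := ltn_trans lt_ij lt_j; rewrite ltnNge leqW.
  + by have := ltn_trans lt_ij lt_j; rewrite ltnNge leqnSn.
  + by have := ltn_trans lt_ij lt_j; rewrite ltnn.
  by rewrite !block_opE !gE ?linear0 !add0r !addr0 addpE !gamma_anti // ltnW.
all: case: (gamma_indexP le_i) => [{le_i}i lt_i|||] lt_ij //;
  try by rewrite ltnNge ?leqnn ?leqnSn ?leqW // in lt_ij.
all: rewrite !block_opE !gE !addpE ?linearD ?linear0 /= ?zK; try rewrite !(zA _ _ lt_i).
all: by congr pair; char2.
Qed.

Lemma double_form_scalar q : scalar (double_form^~ q).
Proof.
move=> c p p'; rewrite /double_form /= !spin_formP mulrDr !addrA.
by congr (_ + _); rewrite -!addrA; congr (_ + _); rewrite addrC.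
Qed.

Lemma double_formC p q : double_form p q = double_form q p.
Proof. by rewrite /double_form addrC spin_formC [spin_form p.1 _]spin_formC. Qed.

Lemma double_form_nondegenerate p : (forall q, double_form p q = 0) -> p = 0.
Proof.
case: p => x y pq0; congr pair; apply: spin_form_nondegenerate => u.
  have := pq0 (0, u); rewrite /double_form /=.
  by rewrite [spin_form y 0]spin_formC spin_form0l addr0.
have := pq0 (u, 0); rewrite /double_form /=.
by rewrite [spin_form x 0]spin_formC spin_form0l add0r.
Qed.

Lemma double_gamma_adjoint i p q : (i <= m.+1.*2)%N ->
  double_form (double_gamma i p) q = double_form p (double_gamma i q).
Proof.
case: p q => x y [x' y'] /gamma_indexP; rewrite /double_gamma /double_form.
have zE u v : spin_form (z u) v = spin_form u (z v) by apply: gamma_adjoint.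
case=> [{}i lt_i|||]; rewrite !block_opE /= !gE ?add0r ?addr0.
- by rewrite !gamma_adjoint // ltnW.
- by rewrite spin_formDl spin_formDr !zE; ring.
- by rewrite spin_formDl spin_formDr !zE; ring.
- by rewrite !spin_formDl !spin_formDr !zE; ring.
Qed.

(** Commuting with the old operators makes each of the four blocks of [a] a scalar. Scalars commute
    with [z], so this 2 x 2 matrix commutes with [e] and [f], hence is scalar. *)
Lemma double_gamma_commutant (a : V * V -> V * V) :
  {morph a : x y / x + y} ->
  (forall i x, (i < m.+1.*2)%N -> a (double_gamma i x) = double_gamma i (a x)) ->
  exists c, forall x, a x = c *: x.
Proof.
move=> aD aG.
have a0 : a 0 = 0 by apply: (addrI (a 0)); rewrite -aD !addr0.
have aE x y : a (x, y) = a (x, 0) + a (0, y).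
  by rewrite -aD; congr (a (_, _)); rewrite ?addr0 ?add0r.
have block_scalar (inj : V -> V * V) (pr : V * V -> V) :
    {morph inj : x y / x + y} -> {morph pr : p q / p + q} ->
    (forall i x, (i < m.*2)%N -> double_gamma i (inj x) = inj (gamma S i x)) ->
    (forall i p, (i < m.*2)%N -> pr (double_gamma i p) = gamma S i (pr p)) ->
    exists c, forall x, pr (a (inj x)) = c *: x.
  move=> injD prD injG prG.
  apply: (@gamma_commutant _ S (fun x => pr (a (inj x)))) => [x y|i x lt_i].
    by rewrite injD aD prD.
  by rewrite -prG // -aG ?injG // doubleS !ltnS -ltnS ltnW // ltnW.
have old_op i x y : (i < m.*2)%N ->
    double_gamma i (x, y) = (gamma S i x, gamma S i y).
  by move=> lt_i; rewrite /double_gamma lt_i block_opE !gE addr0 add0r.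
have injlD : {morph (fun x : V => (x, 0 : V)) : x y / x + y}.
  by move=> x y; congr pair; rewrite addr0.
have injrD : {morph (fun x : V => (0 : V, x)) : x y / x + y}.
  by move=> x y; congr pair; rewrite addr0.
have injlG i x : (i < m.*2)%N -> double_gamma i (x, 0) = (gamma S i x, 0).
  by move=> lt_i; rewrite old_op // linear0.
have injrG i x : (i < m.*2)%N -> double_gamma i (0, x) = (0, gamma S i x).
  by move=> lt_i; rewrite old_op // linear0.
have prlD : {morph (fun p : V * V => p.1) : p q / p + q} by [].
have prrD : {morph (fun p : V * V => p.2) : p q / p + q} by [].
have prlG i p : (i < m.*2)%N -> (double_gamma i p).1 = gamma S i p.1.
  by case: p => x y lt_i; rewrite old_op.
have prrG i p : (i < m.*2)%N -> (double_gamma i p).2 = gamma S i p.2.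
  by case: p => x y lt_i; rewrite old_op.
have [c11 E11] := block_scalar _ _ injlD prlD injlG prlG.
have [c21 E21] := block_scalar _ _ injlD prrD injlG prrG.
have [c12 E12] := block_scalar _ _ injrD prlD injrG prlG.
have [c22 E22] := block_scalar _ _ injrD prrD injrG prrG.
have {}aE x y : a (x, y) = (c11 *: x + c12 *: y, c21 *: x + c22 *: y).
  rewrite aE (surjective_pairing (a (x, 0))) (surjective_pairing (a (0, y))).
  by rewrite E11 E12 E21 E22.
have new0 x y : double_gamma m.*2 (x, y) = (z x + y, z y).
  by rewrite /double_gamma ltnn eqxx block_opE !gE add0r.
have new1 x y : double_gamma m.*2.+1 (x, y) = (z x, x + z y).
  by rewrite /double_gamma ltnNge leqnSn gtn_eqF // eqxx block_opE !gE addr0.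
have Ediag (y : V) : c11 *: y = c22 *: y /\ c21 *: y = 0.
  have := aG m.*2 (0, y); rewrite doubleS leqnSn => /(_ isT).
  rewrite new0 linear0 add0r !aE !scaler0 !add0r new0 !linearZ /=.
  case=> e1 e2; split; first by apply: (addIr (c12 *: z y)); rewrite e1 addrC.
  by apply: (addIr (c22 *: z y)); rewrite e2 add0r.
have E12' (x : V) : c12 *: x = 0.
  have := aG m.*2.+1 (x, 0); rewrite doubleS ltnSn => /(_ isT).
  rewrite new1 linear0 addr0 !aE !scaler0 !addr0 new1 linearZ /=.
  by case=> e _; apply: (addrI (c11 *: z x)); rewrite e addr0.
by exists c11 => -[x y]; rewrite aE E12' (Ediag x).2 addr0 add0r -(Ediag y).1.
Qed.

Lemma spin_module_double : spin_module m.+1.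
Proof.
apply: (@SpinModule m.+1 (V * V)%type double_gamma double_form).
- by rewrite dimvf -[LHS]/(dim V + dim V)%N -dimvf dim_spinor expnS mul2n addnn.
- exact: double_gammaK.
- exact: double_gamma_anti.
- exact: double_form_scalar.
- exact: double_formC.
- exact: double_form_nondegenerate.
- exact: double_gamma_adjoint.
- exact: double_gamma_commutant.
Qed.

End Doubling.

Fixpoint spin_module_of m : spin_module m :=
  if m is m'.+1 then spin_module_double (spin_module_of m') else spin_module0.

(** * Clifford families and their quadratic form *)

Section CliffordFamily.

Variables (V : vectType 'F_2) (T : finType) (w : T -> 'End(V)).
Variable form : V -> V -> 'F_2.
Implicit Types (x y : V) (i j k l : T).

Hypothesis wK : forall i x, w i (w i x) = 0.
Hypothesis wC : forall i j x, i != j -> w i (w j x) + w j (w i x) = x.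
Hypothesis formP : forall y, scalar (form^~ y).
Hypothesis formC : forall x y, form x y = form y x.
Hypothesis form_nondegenerate : forall x, (forall y, form x y = 0) -> x = 0.
Hypothesis w_adjoint : forall i x y, form (w i x) y = form x (w i y).
Hypothesis w_commutant : forall a : V -> V, {morph a : x y / x + y} ->
  (forall i x, a (w i x) = w i (a x)) -> exists c, forall x, a x = c *: x.
Hypothesis card_T : (6 <= #|T|)%N.

Lemma formDl x x' y : form (x + x') y = form x y + form x' y.
Proof. by have := formP y 1 x x'; rewrite scale1r mul1r. Qed.

Lemma formDr x y y' : form x (y + y') = form x y + form x y'.
Proof. by rewrite ![form x _]formC formDl. Qed.

Lemma form0l y : form 0 y = 0.
Proof. by have := formDl 0 0 y; rewrite addr0 -[LHS]addr0 => /addrI. Qed.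

Lemma addFF (c : 'F_2) : c + c = 0.
Proof. exact: (@addvv ('F_2)^o). Qed.

Lemma w_swap i j x : i != j -> w i (w j x) = w j (w i x) + x.
Proof. by move=> ne_ij; apply: addv_eq0; rewrite addrA wC // addvv. Qed.

Lemma exists_neq i : exists j, j != i.
Proof.
have : (0 < #|[set~ i]|)%N by rewrite cardsC1 -subn1 subn_gt0 (leq_trans _ card_T).
by case/card_gt0P => j; rewrite !inE => ne_ji; exists j.
Qed.

(** Writing the first [x] as an anticommutator, both terms become [form (w i x) (w j x)] by
    adjointness and symmetry. *)
Lemma form_alternating x : form x x = 0.
Proof.
have /card_gt0P [i _] : (0 < #|T|)%N by apply: leq_trans card_T.
have [j ne_ji] := exists_neq i.
rewrite -{1}(wC x ne_ji) formDl [form (w j _) _]w_adjoint.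
by rewrite [form (w i (w j x)) _]w_adjoint [form (w j x) _]formC addFF.
Qed.

(* [a = p (r a) + (r a) p] in the Clifford algebra, so that moving [p], [r]
   and [a] to the other side exhibits [form x (a x)] as a sum [t + t]. *)
Lemma form_selfadjoint_eq0 (a p r : V -> V) :
  (forall x y, form (a x) y = form x (a y)) ->
  (forall x y, form (p x) y = form x (p y)) ->
  (forall x y, form (r x) y = form x (r y)) ->
  (forall x, a (p x) = p (a x)) -> (forall x, a (r x) = r (a x)) ->
  (forall x, p (r x) + r (p x) = x) ->
  forall x, form x (a x) = 0.
Proof.
move=> aA pA rA ap ar pr x; rewrite -{1}(pr x) formDl pA [form (r (p x)) _]rA -ap -ar.
by rewrite -[form (p x) _]aA [form (a _) _]formC addFF.
Qed.

(** The action of a vector of norm 1, whose orthogonal transvection swaps the vectors of indices [i]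
    and [j]. *)
Definition transv i j x := w i x + w j x.

Lemma transv_adjoint i j x y : form (transv i j x) y = form x (transv i j y).
Proof. by rewrite formDl formDr !w_adjoint. Qed.

Lemma transv_comm i j k x : k != i -> k != j ->
  w k (transv i j x) = transv i j (w k x).
Proof.
by move=> ki kj; rewrite /transv linearD /= !(@w_swap k) // addrACA addvv addr0.
Qed.

Lemma transvK i j x : i != j -> transv i j (transv i j x) = x.
Proof. by move=> ij; rewrite /transv !linearD /= !wK add0r addr0 wC. Qed.

Lemma transv_transv_comm i j k l x : k != i -> k != j -> l != i -> l != j ->
  transv k l (transv i j x) = transv i j (transv k l x).
Proof.
by move=> ki kj li lj; rewrite {1}/transv !transv_comm // /transv !linearD addrACA.
Qed.

Definition spin_quad i j x := form (w i x) (w j x).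

Lemma spin_quadC i j x : spin_quad i j x = spin_quad j i x.
Proof. exact: formC. Qed.

Lemma spin_quad_change i j k x : j != i -> k != i ->
  spin_quad i j x = spin_quad i k x.
Proof.
move=> ji ki; have [-> //|jk] := eqVneq j k.
have : (2 < #|~: [set i; j; k]|)%N.
  rewrite cardsCs setCK ltn_subRL (leq_trans _ card_T) // -addnS (leq_add2r 3 _ 3).
  by rewrite setUC cardsU1 cards2; case: (_ \notin _); case: (i == j).
case/card_gt2P => a [b [c [[]]]]; rewrite !inE !negb_or => /andP[/andP[ai aj] ak].
move=> /andP[/andP[bi bj] bk] /andP[/andP[ci cj] ck] [ab bc ca].
(* The difference is [form x (w i (transv j k x))]. As [a], [b], [c] avoid [i], [j], [k], both
   [transv a b] and [transv a c] commute with this operator; their anticommutator is a sum of three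
   products equal to 1, hence 1. *)
apply: (@addv_eq0 ('F_2)^o); rewrite -formDr w_adjoint.
apply: (@form_selfadjoint_eq0 (w i \o transv j k) (transv a b) (transv a c)) => /=
  [u v|u v|u v|u|u|u].
- by rewrite w_adjoint transv_adjoint transv_comm // eq_sym.
- exact: transv_adjoint.
- exact: transv_adjoint.
- by rewrite transv_transv_comm // ?transv_comm // eq_sym.
- by rewrite transv_transv_comm // ?transv_comm // eq_sym.
rewrite /transv !linearD /= !wK (w_swap _ ab) (w_swap _ bc) (w_swap _ ca).
by char2.
Qed.

(** If [i != i'], the pair [(i, i')] links the two, using symmetry. *)
Lemma spin_quad_indep i j i' j' x : i != j -> i' != j' ->
  spin_quad i j x = spin_quad i' j' x.
Proof.
move=> ij ij'; have ji : j != i by rewrite eq_sym.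
have [ei|ii'] := eqVneq i i'.
  by subst i'; apply: spin_quad_change; rewrite // eq_sym.
rewrite (spin_quad_change _ ji (_ : i' != i)) 1?eq_sym // spin_quadC.
by apply: spin_quad_change; rewrite // eq_sym.
Qed.

(** * The kernels of the operators *)

Lemma dim_lker i : (2 * \dim (lker (w i)))%N = \dim {:V}.
Proof.
have [j ji] := exists_neq i.
(* On the kernel of [w i] the anticommutator reduces to [x = w i (w j x)]: [w j] is a contracting
   homotopy. *)
have kerE : lker (w i) = limg (w i).
  apply/eqP; rewrite eqEsubv; apply/andP; split; apply/subvP => x.
    rewrite memv_ker => /eqP wx; rewrite -(wC x ji) wx linear0 add0r.
    exact/memv_img/memvf.
  by case/memv_imgP => y _ ->; rewrite memv_ker wK.
by rewrite -(limg_ker_dim (w i) fullv) capfv -kerE addnn mul2n.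
Qed.

Lemma lker_cap i j : i != j -> (lker (w i) :&: lker (w j) = 0)%VS.
Proof.
move=> ij; apply/eqP; rewrite -subv0; apply/subvP => x.
rewrite memv_cap !memv_ker memv0 => /andP[/eqP wi /eqP wj].
by rewrite -(wC x ij) wi wj !linear0 addr0.
Qed.

(** * Isometries inducing permutations of the indices *)

Definition intertwiner (s : T -> T) (u : 'End(V)) : Prop :=
  (forall i x, w (s i) (u x) = u (w i x)) /\
  (forall x y, form (u x) (u y) = form x y).

Lemma intertwiner_id : intertwiner id \1%VF.
Proof. by split=> *; rewrite !id_lfunE. Qed.

Lemma intertwiner_comp s t u v :
  intertwiner s u -> intertwiner t v -> intertwiner (s \o t) (u \o v)%VF.
Proof.
move=> [uw uF] [vw vF]; split=> *; rewrite !comp_lfunE /= ?uw ?vw //.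
by rewrite uF vF.
Qed.

(** As squares vanish, [w j (w i + w j) = w j w i = (w i + w j) w i]. The sum is a self-adjoint
    involution, hence preserves the form. *)
Lemma intertwiner_tperm i j : i != j -> intertwiner (tperm i j) (w i + w j).
Proof.
move=> ij; split=> [k x|x y]; rewrite !add_lfunE; last first.
  by rewrite transv_adjoint transvK.
case: tpermP => [->|->|/eqP ki /eqP kj]; rewrite ?linearD /= ?wK ?add0r ?addr0 //.
by rewrite -linearD; apply: transv_comm.
Qed.

Lemma exists_intertwiner (s : {perm T}) : exists u, intertwiner s u.
Proof.
have [ts -> {s}] := prod_tpermP s; elim: ts => [_|[i j] ts IHts] /=.
  rewrite big_nil; exists \1%VF; case: intertwiner_id => uw uF; split=> // k x.
  by rewrite perm1 uw.
case/andP=> /= ij /IHts [u [uw uF]].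
have [vw vF] := intertwiner_tperm ij.
(* Products of permutations apply the left factor first, so the transposition acts before [u]. *)
exists (u \o (w i + w j))%VF; rewrite big_cons; split=> *.
  by rewrite permM !comp_lfunE uw vw.
by rewrite !comp_lfunE uF vF.
Qed.

Lemma intertwiner_ker0 s u : intertwiner s u -> lker u = 0%VS.
Proof.
move=> [_ uF]; apply/eqP; rewrite -subv0; apply/subvP => x.
rewrite memv_ker memv0 => /eqP ux; apply/eqP/form_nondegenerate => y.
by rewrite -uF ux form0l.
Qed.

(** Composing with an intertwiner of the inverse permutation lands in the commutant, hence gives a
    scalar, which must be the identity. *)
Lemma intertwiner_unique (s : {perm T}) u v :
  intertwiner s u -> intertwiner s v -> u = v.
Proof.
have [t tI] := exists_intertwiner s^-1.
have t_inv u' : intertwiner s u' -> (t \o u')%VF = \1%VF.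
  move=> u'I; have [cw cF] := intertwiner_comp tI u'I.
  have [x y|i x|c cE] := @w_commutant (t \o u')%VF; first exact: linearD.
    by rewrite -cw /= permK.
  apply/lfunP => x; rewrite cE id_lfunE.
  (* The scalar 0 preserves a nondegenerate form only on the zero space. *)
  have [c0|->] := F2E c; last by rewrite scale1r.
  suff -> : x = 0 by rewrite scaler0.
  apply: form_nondegenerate => y.
  by rewrite -cF !cE c0 !scale0r form0l.
move=> /t_inv tu /t_inv tv.
have /eqP/lker0P t_inj := intertwiner_ker0 tI.
apply/lfunP => x; apply: t_inj.
by have /lfunP/(_ x) := tu; rewrite -tv !comp_lfunE.
Qed.

Lemma intertwiner_img (s : {perm T}) u i :
  intertwiner s u -> (u @: lker (w i))%VS = lker (w (s i)).
Proof.
move=> uI; have [uw _] := uI; apply/eqP; rewrite eqEdim; apply/andP; split.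
  apply/subvP => y /memv_imgP [x]; rewrite memv_ker => /eqP wx ->.
  by rewrite memv_ker uw wx linear0.
rewrite limg_dim_eq ?(intertwiner_ker0 uI) ?capv0 //.
by rewrite -(leq_pmul2l (ltn0Sn 1)) !dim_lker.
Qed.

(** * The quadratic form and its polarization *)

Fact form_bilinear : bilinear_for *%R *%R form.
Proof.
split=> [y|x] c u v; first exact: formP.
by rewrite ![form x _]formC formP.
Qed.

HB.instance Definition _ :=
  bilinear_isBilinear.Build 'F_2 V V 'F_2 *%R *%R form form_bilinear.

Variables (i0 j0 : T).
Hypothesis ij0 : i0 != j0.

Lemma spin_quadZ c x : spin_quad i0 j0 (c *: x) = c ^+ 2 * spin_quad i0 j0 x.
Proof.
have formZ d u v : form (d *: u) v = d * form u v.
  by have := formP v d u 0; rewrite addr0 form0l addr0.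
by rewrite /spin_quad !linearZ /= formZ formC formZ formC expr2 mulrA.
Qed.

(** The cross terms are, by adjointness, the anticommutator of [w i0] and [w j0] applied to [x] and
    paired with [y]. *)
Lemma spin_quadD x y :
  spin_quad i0 j0 (x + y) = spin_quad i0 j0 x + spin_quad i0 j0 y + form x y.
Proof.
have -> : form x y = form (w i0 y) (w j0 x) + form (w i0 x) (w j0 y).
  rewrite -{1}(wC x ij0) formDl [form (w i0 (w j0 x)) _]w_adjoint.
  by rewrite [form (w j0 (w i0 x)) _]w_adjoint [form (w j0 x) _]formC.
by rewrite /spin_quad !linearD /= !formDl !formDr; ring.
Qed.

Definition spin_qform : quadratic_form V :=
  @QuadraticForm 'F_2 V (spin_quad i0 j0) form spin_quadZ spin_quadD form_alternating.

End CliffordFamily.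

(** * The regular action of the group on the kernels *)

Local Open Scope fset_scope.

Theorem corollary1 (gT : finGroupType) (G : {group gT}) (m : nat) :
  (6 <= #|G|)%N -> m = (#|G| %/ 2)%N ->
  exists (V : vectType 'F_2) (Q : quadratic_form V) (rho : gT -> 'End(V))
         (S : {fset {vspace V}}),
    (\dim {:V} = 2 ^ m)%N /\
    nondegenerate_qform Q /\
    has_index Q (2 ^ (m - 1))%N /\
    linear_action G rho /\
    (forall g, g \in G -> qform_isometry Q (rho g)) /\
    partial_orthogonal_spread Q (2 ^ (m - 1))%N S /\
    #|` S| = #|G| /\
    permutes_regularly G rho S.
Proof.
move=> G6 mE; pose T : finGroupType := [subg G].
have cardT : #|T| = #|G| by rewrite card_sub.
have T6 : (6 <= #|T|)%N by rewrite cardT.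
pose M := spin_module_of m; pose w (x : T) := gamma M (enum_rank x).
have m_gt0 : (0 < m)%N by rewrite mE divn_gt0 // (leq_trans _ G6).
(* The upper bound keeps every rank among the indices [0] to [2m]; the lower bound makes the family
   contain all operators of the commutant clause. *)
have card_ub : (#|T| <= m.*2.+1)%N.
  by rewrite cardT mE divn2 -[leqLHS]odd_double_half -add1n leq_add2r leq_b1.
have card_lb : (m.*2 <= #|T|)%N.
  by rewrite cardT mE divn2 -[leqRHS]odd_double_half leq_addl.
have rank_le (x : T) : (enum_rank x <= m.*2)%N by rewrite -ltnS (leq_trans _ card_ub).
have wK x v : w x (w x v) = 0 by apply: gammaK.
have wC x y v : x != y -> (w x (w y v) + w y (w x v) = v)%R.
  move=> xy; have : enum_rank x != enum_rank y :> nat.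
    by apply: contra xy => /eqP/val_inj/enum_rank_inj ->.
  by case: ltngtP => // lt _; [|rewrite addrC]; apply: gamma_anti.
have w_adj x u v : spin_form (w x u) v = spin_form u (w x v).
  exact: gamma_adjoint.
have w_comm (a : M -> M) : {morph a : x y / (x + y)%R} ->
    (forall i x, a (w i x) = w i (a x)) -> exists c, forall x, a x = c *: x.
  move=> aD aw; apply: gamma_commutant aD _ => i x lt_i.
  have := aw (enum_val (Ordinal (leq_trans lt_i card_lb))) x.
  by rewrite /w enum_valK.
have formP := @spin_formP _ M; have formC := @spin_formC _ M.
have form_nd := @spin_form_nondegenerate _ M.
have /card_gt0P [x0 _] : (0 < #|T|)%N by apply: leq_trans T6.
have [x1 x10] := exists_neq T6 x0.
pose Q := spin_qform wC formP formC w_adj T6 x10.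
have Qnd : nondegenerate_qform Q by move=> u Qu; apply: form_nd.
have QE x y v : x != y -> Q v = spin_form (w x v) (w y v).
  move=> xy.
  apply: (spin_quad_indep wK wC formP formC w_adj T6) => //.
have dimM : \dim {:M} = (2 ^ m)%N by apply: dim_spinor.
have dimK x : \dim (lker (w x)) = (2 ^ (m - 1))%N.
  apply/eqP; rewrite -(eqn_pmul2l (ltn0Sn 1)) (dim_lker wK wC T6) dimM -expnS.
  by rewrite subn1 prednK.
(* [Q] is evaluated on a pair containing [x], so that one argument of the form vanishes. *)
have singK x : totally_singular Q (lker (w x)).
  move=> v; rewrite memv_ker => /eqP wv; have [y yx] := exists_neq T6 x.
  by rewrite (QE y x) // wv formC (form0l formP).
have capK x y : x != y -> (lker (w x) :&: lker (w y) = 0)%VS by apply: lker_cap.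
have K_inj : injective (fun x => lker (w x)).
  move=> x y exy; apply/eqP/negPn/negP => /capK.
  rewrite exy capvv => K0; have := dimK y.
  by rewrite K0 dimv0 => /esym/eqP; rewrite expn_eq0.
(* The permutation is left multiplication by [x], which makes the action regular. *)
have int_ex (x : T) := exists_intertwiner wK wC formP formC w_adj (perm (mulgI x)).
have [U UI] := fin_all_exists int_ex.
have int_uniq := intertwiner_unique wK wC formP formC form_nd w_adj w_comm.
have Uimg x y : (U x @: lker (w y))%VS = lker (w (x * y)%g).
  by rewrite (intertwiner_img wK wC formP form_nd T6 y (UI x)) permE.
exists M, Q, (fun g => U (subg G g)), [fset lker (w x) | x in T].
split=> //; split=> //; split.
  by split=> //; [rewrite dimM -expnS subn1 prednK | exists (lker (w x0))].
split.
  (* Multiplicativity follows from uniqueness: both sides intertwine the same permutation. *)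
  split=> [|g h Gg Gh]; apply: (int_uniq _ _ _ (UI _)); first rewrite morph1.
    have [iw iF] := intertwiner_id w (@spin_form _ M).
    by split=> // x v; rewrite permE /= mul1g iw.
  rewrite subgM //; have [iw iF] := intertwiner_comp (UI (subg G g)) (UI (subg G h)).
  by split=> // x v; rewrite -iw /= !permE mulgA.
split.
  move=> g _; split=> [|v]; first exact: (intertwiner_ker0 formP form_nd (UI (subg G g))).
  (* At the image vector, [Q] is computed with the pair shifted by [s], which the intertwiner pulls
     back to the pair defining [Q]. *)
  have [uw uF] := UI (subg G g); pose s := perm (mulgI (subg G g)).
  have ne' : s x1 != s x0 by rewrite (inj_eq perm_inj).
  by rewrite (QE _ _ _ ne') !uw uF.
have memS x : lker (w x) \in [fset lker (w x) | x in T] by apply/imfsetP; exists x.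
have inS W : W \in [fset lker (w x) | x in T] -> exists x, W = lker (w x).
  by case/imfsetP => x _ ->; exists x.
split.
  split=> [W /inS[x ->] // | W W' /inS[x ->] /inS[y ->] ne].
  by apply: capK; apply: contraNneq ne => ->.
split; first by rewrite card_imfset //= -cardT cardE.
split=> [g W Gg /inS[x ->]|W W' /inS[x ->] /inS[y ->]|g W Gg /inS[x ->]].
- by rewrite Uimg memS.
- exists (sgval (y * x^-1)%g); first exact: subgP.
  by rewrite sgvalK Uimg mulgKV.
rewrite Uimg => /K_inj /(canRL (mulgK _)); rewrite mulgV => g1.
by rewrite -[g](@subgK _ G) // g1.
Qed.
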